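(* Let $(V,\|\cdot\|)$ be a finite-dimensional normed space and let $T\colon V\to V$ be a firm non-expansive mapping. Suppose that $\rho(T)=0$. Then either $T$ has bounded orbits, or there is a metric functional $h$ on $V$ such that, for every $x\in V$, the sequence $(h(T^{n}x))_{n}$ converges monotonically to $-\infty$ (that is, it is non-increasing and tends to $-\infty$), and moreover this metric functional $h$ is a limit point of the orbit $(T^{n}0)_{n\geq 0}$, in the sense that $h$ is a limit point of the sequence $(\Phi(T^{n}0))_{n\geq 0}$ in $\overline{\Phi(V)}$.
   Context: $V$ is regarded as a metric space with $\delta(x,y)=\|x-y\|$. A mapping $T\colon V\to V$ is non-expansive if $\delta(Tx,Ty)\leq\delta(x,y)$ for every $x,y\in V$. A mapping $T\colon V\to V$ is firm if there exist mappings $q,r,s,t\colon V\times V\to[0,+\infty[$ such that (A) $\inf_{(x,y)\in V\times V}t(x,y)>0$; (B) $\sup_{(x,y)\in V\times V}\big(q(x,y)+r(x,y)+s(x,y)+2t(x,y)\big)\leq 1$; (C) for every $x,y\in V$, $$\delta(Tx,Ty)\leq q(x,y)\,\delta(x,y)+r(x,y)\,\delta(x,Tx)+s(x,y)\,\delta(y,Ty)+t(x,y)\big[\delta(x,Ty)+\delta(Tx,y)\big].$$ $T$ is firm non-expansive if it is both firm and non-expansive. For non-expansive $T$, the linear rate of escape is $\rho(T):=\lim_{n\to\infty}\delta(x,T^{n}x)/n$; this limit exists and does not depend on $x\in V$. The orbit of $x$ under $T$ is the sequence $(T^nx)_{n\ge 0}$. Metric functionals: fix an arbitrary base-point $x_0\in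 V$ (e.g. $x_0=0$). For $w\in V$ let $h_w\colon V\to\mathbb{R}$, $h_w(\cdot):=\delta(\cdot,w)-\delta(x_0,w)$, and let $\Phi\colon V\to\mathbb{R}^V$, $\Phi(w):=h_w$. Endow $\mathbb{R}^V$ with the topology of point-wise convergence. A metric functional on $V$ is an element of the closure $\overline{\Phi(V)}$ in $\mathbb{R}^V$ (which is a compact space). A limit point of a sequence $(g_n)_{n\ge0}$ in $\overline{\Phi(V)}$ means the limit of some subsequence $(g_{n_i})_i$ with $n_i\to\infty$. *)

(* Defs.v *)
From HB Require Import structures.
From mathcomp Require Import all_boot all_order all_algebra.
From mathcomp Require Import all_classical all_reals all_analysis.

Set Implicit Arguments.
Unset Strict Implicit.
Unset Printing Implicit Defensive.

Import Order.TTheory GRing.Theory Num.Theory.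
Import numFieldNormedType.Exports.

Local Open Scope classical_set_scope.
Local Open Scope ring_scope.

(* [Vector.axiom n V] is the type of linear bijections from V to 'rV_n. *)
Definition finite_dimensional (R : realType) (V : normedModType R) : Prop :=
  exists n : nat, inhabited (Vector.axiom n V).

Definition dist (R : realType) (V : normedModType R) (x y : V) : R :=
  `|x - y|.

Definition non_expansive (R : realType) (V : normedModType R) (T : V -> V) :
    Prop :=
  forall x y : V, dist (T x) (T y) <= dist x y.

(* The infimum and supremum are taken in \bar R, because [sup] on R is 0 on
   unbounded sets. *)
Definition firm (R : realType) (V : normedModType R) (T : V -> V) : Prop :=
  exists q r s t : V * V -> R,
    [/\ forall p, [/\ 0 <= q p, 0 <= r p, 0 <= s p & 0 <= t p],
        (0 < ereal_inf (range (fun p => (t p)%:E)))%E,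
        (ereal_sup (range (fun p => (q p + r p + s p + 2 * t p)%:E)) <= 1)%E &
        forall x y : V,
          dist (T x) (T y) <=
            q (x, y) * dist x y + r (x, y) * dist x (T x)
            + s (x, y) * dist y (T y)
            + t (x, y) * (dist x (T y) + dist (T x) y)].

(* For non-expansive T the limit exists and is the same along every orbit, so
   the orbit of 0 is used. *)
Definition escape_rate (R : realType) (V : normedModType R) (T : V -> V) : R :=
  lim (dist 0 (iter n T 0) / n%:R @[n --> \oo]).

Definition bounded_orbits (R : realType) (V : normedModType R) (T : V -> V) :
    Prop :=
  forall x : V, bounded_set (range (fun n => iter n T x)).

Definition Phi (R : realType) (V : normedModType R) (x0 w : V) :
    {ptws V -> R} :=
  fun x => dist x w - dist x0 w.

Definition metric_functional (R : realType) (V : normedModType R) (x0 : V) :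
    set {ptws V -> R} :=
  closure (range (Phi x0)).

(* The library's [limit_point] is about sets; this one is about sequences. *)
Definition seq_limit_point (X : topologicalType) (g : nat -> X) (l : X) :
    Prop :=
  exists2 f : nat -> nat, increasing_seq f & g (f i) @[i --> \oo] --> l.

(* Main.v *)
Require Import Defs.
From mathcomp Require Import all_boot all_order all_algebra.
From mathcomp Require Import all_classical all_reals all_analysis.
From mathcomp Require Import ring lra zify.
Import Order.TTheory GRing.Theory Num.Theory.
Import numFieldNormedType.Exports.
Local Open Scope classical_set_scope.
Local Open Scope ring_scope.

(** Write a_n for T^n 0.  Two facts combine.

    (1) Asymptotic regularity: for a firm non-expansive T, the steps
    |a_{n+1} - a_n| converge to the rate of escape.  The gap |a_n - a_{n+k}| is
    non-increasing in n; call its limit L k.  Applying the firm inequality to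
    the pair (a_n, a_{n+k+1}) and letting n tend to infinity shows that L is
    convex at k+1 as soon as L (k+1) >= L 1 (firm_gap_convex); the coefficient t
    is divided out, which its positive lower bound allows.  By induction, all increments of L are at
    least L 1, so |a_k| >= L k >= k L 1.  Conversely |a_k| is at most the sum of
    the first k steps, and the Cesaro means of the steps converge to L 1.
    Hence |a_k| / k converges to L 1, which is therefore the rate of escape
    (firm_step_cvg_escape_rate).  When the rate is 0, the orbit is a sequence of
    almost fixed points, and any limit point h of Phi along it satisfies
    h (T x) <= h x (almost_fixed_limit_nonincreasing).

    (2) If the orbit is unbounded, compactness gives a subsequence b of it such
    that |b_i| tends to infinity, the directions b_i / |b_i| converge, and
    Phi (b_i) converges to some h (Phi_cvg_subsequence).  For i much larger
    than j, both large, b_j and b_i point in nearly the same direction, so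
    |b_j - b_i| is about |b_i| - |b_j|; in the limit h (b_j) is at most
    |x0| - |b_j| / 2 (metric_functional_cvgNy).  So h is unbounded below on the
    orbit of 0.  As h is non-increasing along orbits and 1-Lipschitz, and two
    orbits stay at bounded distance, h tends to -oo along every orbit. *)

(** * Asymptotic regularity of firm non-expansive maps *)

Lemma firm_coefficients {R : realType} {V : normedModType R} {T : V -> V} :
  firm T -> exists2 t0 : R, 0 < t0 &
    forall x y, exists q r s t : R,
      [/\ [/\ 0 <= q, 0 <= r, 0 <= s & t0 <= t], q + r + s + 2 * t <= 1 &
        dist (T x) (T y) <= q * dist x y + r * dist x (T x) + s * dist y (T y)
                            + t * (dist x (T y) + dist (T x) y)].
Proof.
move=> [q [r [s [t [coef_ge0 inf_t sup_le1 firmT]]]]].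
have inf_le p : (ereal_inf (range (fun p => (t p)%:E)) <= (t p)%:E)%E.
  by apply: ereal_inf_lbound; exists p.
set m := ereal_inf _ in inf_t inf_le.
have m_fin : m \is a fin_num.
  rewrite ge0_fin_numE; last exact: ltW.
  exact: le_lt_trans (inf_le 0) (ltry _).
exists (fine m); first by rewrite fine_gt0// inf_t -ge0_fin_numE// ltW.
move=> x y; exists (q (x, y)), (r (x, y)), (s (x, y)), (t (x, y)).
have [q0 r0 s0 t0] := coef_ge0 (x, y); split => //.
- by split => //; rewrite -lee_fin fineK.
- rewrite -lee_fin; apply: le_trans sup_le1.
  by apply: ereal_sup_ubound; exists (x, y).
Qed.

Lemma non_expansive_iter {R : realType} {V : normedModType R} {T : V -> V} n :
  non_expansive T -> non_expansive (iter n T).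
Proof.
move=> neT x y; elim: n => //= n; exact: le_trans (neT _ _).
Qed.

Lemma cvg_orbit_gap {R : realType} {V : normedModType R} {T : V -> V} x k :
  non_expansive T ->
  exists2 l : R, dist (iter n T x) (iter (n + k) T x) @[n --> \oo] --> l &
    forall n, l <= dist (iter n T x) (iter (n + k) T x).
Proof.
move=> neT; pose d n := dist (iter n T x) (iter (n + k) T x).
have d_noninc : nonincreasing_seq d.
  by apply/nonincreasing_seqP => n; rewrite /d addSn !iterS; exact: neT.
have d_cvg : cvgn d.
  apply: nonincreasing_is_cvgn => //; exists 0 => _ [n _ <-]; exact: normr_ge0.
by exists (limn d) => //; exact: nonincreasing_cvgn_ge.
Qed.

(** Here [L j] is the limit of the gap of lag [j] along the orbit.  In the firm
    inequality for the points of indices [n] and [n + k.+1], the distances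
    multiplied by [r] and [s] have limit [L 1 <= L k.+1], so that these terms
    can be merged with the term in [q]; since [q + r + s <= 1 - 2 * t], what remains
    is [t * (2 * L k.+1) <= t * (L k + L k.+2)]. *)
Lemma firm_gap_convex {R : realType} {V : normedModType R} {T : V -> V} x
    (L : nat -> R) k :
  firm T ->
  (forall j, dist (iter n T x) (iter (n + j) T x) @[n --> \oo] --> L j) ->
  (forall j n, L j <= dist (iter n T x) (iter (n + j) T x)) ->
  0 <= L 1 -> L 1 <= L k.+1 -> 2 * L k.+1 <= L k + L k.+2.
Proof.
move=> /firm_coefficients[t0 t0_gt0 firmT] cvgL L_le L1_ge0 L1_le.
rewrite leNgt; apply/negP => gapL.
pose e := t0 * (2 * L k.+1 - (L k + L k.+2)) / 2.
have e_gt0 : 0 < e by rewrite divr_gt0 ?mulr_gt0 ?subr_gt0.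
(* The coefficients depend on [n] and need not converge, so the limit is taken
   by hand, with error [e]: the firm inequality will give
   [t * (2 * L k.+1 - (L k + L k.+2)) <= e], but [t0 <= t] makes the left-hand
   side at least [2 * e]. *)
have near_le j : exists N, forall n, (N <= n)%N ->
    dist (iter n T x) (iter (n + j) T x) <= L j + e.
  have /cvgr_le /(_ (L j + e)) := cvgL j.
  by rewrite ltrDl => /(_ e_gt0) [N _ leN]; exists N.
have [N1 le1] := near_le 1; have [Nk lek] := near_le k.
have [Nk1 lek1] := near_le k.+1; have [Nk2 lek2] := near_le k.+2.
have [n [nN1 nNk nNk1 nNk2]] :
    exists n, [/\ (N1 <= n)%N, (Nk <= n)%N, (Nk1 <= n)%N & (Nk2 <= n)%N].
  by exists (N1 + Nk + Nk1 + Nk2)%N; split; lia.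
have A_le := lek1 _ nNk1; have B_le := le1 _ nN1; have D_le := lek2 _ nNk2.
have C_le : dist (iter (n + k.+1) T x) (iter (n + k.+1 + 1) T x) <= L 1 + e.
  by apply: le1; lia.
have E_le : dist (iter n.+1 T x) (iter (n.+1 + k) T x) <= L k + e.
  by apply: lek; lia.
have [q [r [s [t [[q0 r0 s0 t0_le] sum_le1]]]]] :=
  firmT (iter n T x) (iter (n + k.+1) T x).
have := L_le k.+1 n.+1.
rewrite addn1 in B_le; rewrite addn1 in C_le; rewrite addnS in D_le.
rewrite addSnnS in E_le; rewrite addSn -!iterS => Lk1_le.
move/(le_trans Lk1_le); apply/negP; rewrite -ltNge.
set X := L k.+1 + e in A_le.
have X_ge0 : 0 <= X by rewrite addr_ge0 ?(ltW e_gt0)// (le_trans L1_ge0).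
have L1X : L 1 + e <= X by rewrite lerD2r.
have t_ge0 : 0 <= t by rewrite (le_trans _ t0_le)// ltW.
apply: (@le_lt_trans _ _ (q * X + r * X + s * X
                          + t * (L k.+2 + e + (L k + e)))).
  by rewrite !lerD// ler_wpM2l// ?lerD// (le_trans _ L1X).
have sumX : (q + r + s) * X <= (1 - 2 * t) * X by rewrite ler_wpM2r//; lra.
have et : 2 * e <= t * (2 * L k.+1 - (L k + L k.+2)).
  by rewrite /e mulrC divfK ?pnatr_eq0// ler_wpM2r// subr_ge0 ltW.
move: sumX; rewrite /X; lra.
Qed.

Lemma dist_iter_le_sum {R : realType} {V : normedModType R} (T : V -> V) x n :
  dist x (iter n T x) <= \sum_(0 <= k < n) dist (iter k T x) (iter k.+1 T x).
Proof.
elim: n => [|n IHn]; first by rewrite big_geq// /dist subrr normr0.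
rewrite big_nat_recr//=; apply: le_trans (lerD IHn (lexx _)).
exact: ler_distD.
Qed.

(** The definition of [escape_rate] as a [lim] carries information only once
    the convergence of [|T^n 0| / n] is known; the squeeze below proves it and
    identifies the limit at the same time. *)
Lemma firm_step_cvg_escape_rate {R : realType} {V : normedModType R}
    {T : V -> V} :
  firm T -> non_expansive T ->
  dist (iter n T 0) (iter n.+1 T 0) @[n --> \oo] --> escape_rate T.
Proof.
move=> firmT neT.
have /choice[L LP] : forall j, exists l : R,
    (dist (iter n T 0) (iter (n + j) T 0) @[n --> \oo] --> l) /\
    forall n, l <= dist (iter n T 0) (iter (n + j) T 0).
  by move=> j; have [l] := cvg_orbit_gap (0 : V) j neT; exists l.
have cvgL j := (LP j).1; have L_le j := (LP j).2.
have L_ge0 j : 0 <= L j.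
  by apply: (cvgr_to_ge (cvgL j)); apply: nearW => n; exact: normr_ge0.
have incr k : L k + L 1 <= L k.+1.
  elim: k => [|k IHk].
    suff -> : L 0 = 0 by rewrite add0r.
    by apply/le_anti/andP; split; rewrite ?L_ge0//;
      have := L_le 0 0; rewrite /dist subrr normr0.
  have L1_le : L 1 <= L k.+1 by apply: le_trans IHk; rewrite lerDr.
  have := firm_gap_convex 0 L k firmT cvgL L_le (L_ge0 1) L1_le; lra.
have lower n : n%:R * L 1 <= L n.
  elim: n => [|n IHn]; first by rewrite mul0r.
  by rewrite -natr1 mulrDl mul1r (le_trans _ (incr n))// lerD2r.
pose step n := dist (iter n T 0) (iter n.+1 T 0).
have step_cvg : step n @[n --> \oo] --> L 1.
  by under eq_fun do rewrite /step -addn1; exact: cvgL.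
suff : dist 0 (iter n T 0) / n%:R @[n --> \oo] --> L 1.
  by move=> /cvg_lim => /(_ (@Rhausdorff R)) rateE; rewrite /escape_rate rateE.
rewrite -cvg_shiftS.
apply: (squeeze_cvgr _ (cvg_cst (L 1)) (cesaro step_cvg)).
apply: nearW => n; apply/andP; split.
  rewrite ler_pdivlMr ?ltr0n// mulrC (le_trans (lower _))//.
  exact: (L_le n.+1 0).
rewrite /arithmetic_mean seriesEnat/= mulrC ler_wpM2l ?invr_ge0 ?ler0n//.
exact: (dist_iter_le_sum T 0 n.+1).
Qed.

(** * Subsequences, compact balls and finite nets *)

(** Diagonal extraction: [f k] only has to satisfy the [k]-th requirement, which
    suffices when the requirements get stronger with [k]. *)
Lemma extract_increasing {P : nat -> nat -> Prop} :
  (forall k N, exists2 n, (N <= n)%N & P k n) ->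
  exists2 f : nat -> nat, increasing_seq f & forall k, P k (f k).
Proof.
move=> cofinal.
have /choice[g gP] : forall kN : nat * nat, exists n, (kN.2 <= n)%N /\ P kN.1 n.
  by move=> [k N]; have [n] := cofinal k N; exists n.
pose f := fix f k := if k is k'.+1 then g (k, (f k').+1) else g (0, 0)%N.
exists f; last by case=> [|k]; 
  [exact: (gP (0, 0)%N).2|exact: (gP (k.+1, (f k).+1)).2].
by apply/increasing_seqP => k; exact: (gP (k.+1, (f k).+1)).1.
Qed.

Lemma increasing_seq_cvg_oo {f : nat -> nat} :
  increasing_seq f -> f @ \oo --> \oo.
Proof.
move=> f_incr A [N _ NA]; exists N => // n /= Nn; apply: NA => /=.
apply: leq_trans Nn _; elim: n => // n IHn.
by apply: leq_ltn_trans IHn _; move/increasing_seqP : f_incr; exact.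
Qed.

(** In coordinates, the norm of [V] is a continuous function on row vectors; its
    minimum [m] on the unit sphere is positive, so [m] times the coordinate
    norm is at most the norm of [V].  A ball of [V] is then a closed subset of
    the image of a ball of row vectors. *)
Lemma finite_dimensional_closed_ball_compact {R : realType}
    {V : normedModType R} (r : R) :
  finite_dimensional V -> compact [set x : V | `|x| <= r].
Proof.
move=> [n [[c c_lin [g gK cK]]]].
have g_lin a u v : g (a *: u + v) = a *: g u + g v.
  by apply: (can_inj gK); rewrite cK c_lin !cK.
have g0 : g 0 = 0.
  by have := g_lin (-1) 0 0; rewrite !scaleN1r oppr0 addr0 addNr.
have gD u v : g (u + v) = g u + g v by rewrite -(scale1r u) g_lin !scale1r.
have gZ a v : g (a *: v) = a *: g v by rewrite -[a *: v]addr0 g_lin g0 addr0.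
have gE v : g v = \sum_j v 0 j *: g (delta_mx 0 j).
  rewrite {1}(row_sum_delta v).
  rewrite (big_morph g gD g0); apply: eq_bigr => j _; exact: gZ.
have g_cont : continuous g.
  rewrite (_ : g = fun v => \sum_j v 0 j *: g (delta_mx 0 j)); last exact/funext.
  apply: continuous_big => [|j _ v]; first exact: add_continuous.
  by apply: cvgZr_tmp; [exact: (nbhs_filter v)|exact: coord_continuous].
have [m m_gt0 m_le] : exists2 m : R, 0 < m & forall v, m * `|v| <= `|g v|.
  pose S : set 'rV[R]_n := [set v | `|v| = 1].
  have S_compact : compact S.
    apply: bounded_closed_compact.
      by exists 1; split; rewrite ?num_real// => y y1 v /= ->; exact: ltW.
    by apply: (preimage_closed _ (@closed_eq _ 1)) => v _; exact: norm_continuous.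
  (* The sphere is empty exactly in dimension 0. *)
  have [S0|/set0P S_neq0] := eqVneq S set0.
    exists 1 => // v; have [->|v_neq0] := eqVneq v 0; first by rewrite normr0 mulr0.
    suff : S (`|v|^-1 *: v) by rewrite S0.
    by rewrite /S/= normrZ normfV normr_id mulVf ?normr_eq0.
  have [|u /set_mem u1 u_min] := EVT_min_rV (f := fun v => `|g v|) S_neq0 S_compact.
    apply: continuous_subspaceT => v.
    by apply: (continuous_comp (g_cont v)); exact: norm_continuous.
  exists `|g u|.
    rewrite normr_gt0; apply/eqP => gu0.
    have u0 : u = 0 by rewrite -(cK u) gu0 -g0 cK.
    by move: u1; rewrite /S/= u0 normr0 => /esym/eqP; rewrite oner_eq0.
  move=> v; have [->|v_neq0] := eqVneq v 0; first by rewrite normr0 mulr0.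
  have /mem_set/u_min : S (`|v|^-1 *: v).
    by rewrite /S/= normrZ normfV normr_id mulVf ?normr_eq0.
  by rewrite gZ normrZ normfV normr_id ler_pdivlMl ?normr_gt0// mulrC.
pose K : set 'rV[R]_n := [set v | `|v| <= r / m].
have K_compact : compact K.
  apply: bounded_closed_compact.
    exists (r / m); split; rewrite ?num_real// => y y1 v.
    by move=> /= /le_trans; apply; exact: ltW.
  by apply: (preimage_closed _ (@closed_le _ _)) => v _; exact: norm_continuous.
have gK_compact : compact (g @` K).
  by apply: continuous_compact => //; apply: continuous_subspaceT.
apply: (subclosed_compact _ gK_compact).
  by apply: (preimage_closed _ (@closed_le _ _)) => v _; exact: norm_continuous.
move=> x /= xr; exists (c x); last exact: gK.
by rewrite /K/= ler_pdivlMr// mulrC (le_trans (m_le _))// gK.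
Qed.

Lemma compact_finite_net {R : realType} {V : normedModType R} {A : set V}
    {e : R} :
  compact A -> 0 < e ->
  exists D : seq V, forall x, A x -> exists2 d, d \in D & `|x - d| < e.
Proof.
move=> A_compact e_gt0.
have : cover_compact A by rewrite -compact_cover.
move=> /(_ V setT (fun d => ball d e)) [d _||D _ D_cover].
- exact: ball_open.
- by move=> x _; exists x => //; exact: ballxx.
- exists (finmap.enum_fset D) => x /D_cover [d /= dD].
  by rewrite -ball_normE/= distrC => xd; exists d.
Qed.

Lemma near_all_seq {T : Type} {I : eqType} {F : set_system T} {Q : I -> set T}
    {s : seq I} :
  Filter F -> (forall i, F (Q i)) -> F [set x | forall i, i \in s -> Q i x].
Proof.
move=> FF FQ; elim: s => [|i s IHs]; first by apply: nearW.
apply: filterS2 (FQ i) IHs => x Qix Qsx j.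
by rewrite inE => /orP[/eqP ->|/Qsx].
Qed.

(** * Limits of metric functionals *)

Lemma Phi_lipschitz {R : realType} {V : normedModType R} (x0 w x y : V) :
  `|Phi x0 w x - Phi x0 w y| <= `|x - y|.
Proof.
rewrite /Phi /dist opprB addrA subrK.
by apply: le_trans (ler_dist_dist _ _) _; rewrite opprB addrA subrK.
Qed.

Lemma Phi_bound {R : realType} {V : normedModType R} (x0 w x : V) :
  `|Phi x0 w x| <= `|x - x0|.
Proof.
by rewrite -[Phi x0 w x]subr0 -[0 as X in _ - X](subrr (dist x0 w)) Phi_lipschitz.
Qed.

Lemma ptws_eval_cvg {R : realType} {V : normedModType R}
    {F : set_system {ptws V -> R}} {h : {ptws V -> R}} :
  Filter F -> (F --> h) <-> forall x, phi x @[phi --> F] --> h x.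
Proof. by move=> FF; exact: pointwise_cvgP. Qed.

Lemma ptws_limit_lipschitz {R : realType} {V : normedModType R}
    {F : set_system {ptws V -> R}} {h : {ptws V -> R}} :
  ProperFilter F -> F [set phi | forall x y, `|phi x - phi y| <= `|x - y|] ->
  F --> h -> forall x y, `|h x - h y| <= `|x - y|.
Proof.
move=> FF F_lip /ptws_eval_cvg F_h x y.
apply: (cvgr_to_le (cvg_norm (cvgB (F_h x) (F_h y)))).
by apply: filterS F_lip => phi; exact.
Qed.

(** The pairs ([u n], [Phi x0 (b n)]) lie in the product of a ball and of a cube
    of functions, compact by Tychonoff, so they have a cluster point [(v, h)].
    The topology of pointwise convergence is in general not metrizable, but
    all functions involved are 1-Lipschitz: it is enough to approximate [h] within
    [1 / (k + 1)] on a finite net of the ball of radius [k], which is a single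
    neighbourhood of [h] for each [k]. *)
Lemma Phi_cvg_subsequence {R : realType} {V : normedModType R} (x0 : V)
    (b u : nat -> V) :
  (forall r : R, compact [set x : V | `|x| <= r]) ->
  (forall n, `|u n| <= 1) ->
  exists2 f : nat -> nat, increasing_seq f &
    exists (v : V) (h : {ptws V -> R}),
      u (f i) @[i --> \oo] --> v /\ Phi x0 (b (f i)) @[i --> \oo] --> h.
Proof.
move=> V_proper u_le1.
pose box := [set phi : {ptws V -> R} |
  forall x, `[(- `|x - x0|), `|x - x0|]%classic (phi x)].
have box_compact : compact box.
  apply: (@tychonoff V (fun _ => R) (fun x => `[(- `|x - x0|), `|x - x0|]%classic)).
  by move=> x; exact: segment_compact.
pose w n : V * {ptws V -> R} := (u n, Phi x0 (b n)).
have w_in : \forall n \near \oo, ([set v : V | `|v| <= 1] `*` box) (w n).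
  apply: nearW => n; split => /=; first exact: u_le1.
  by move=> x; rewrite /= in_itv/= -ler_norml Phi_bound.
have [[v h] [_]] := compact_setX (V_proper 1) box_compact
  (fmap_proper_filter w eventually_filter) w_in.
(* [G] is a filter finer than the sequence and convergent to [(v, h)]. *)
rewrite cluster_cvgE => -[G G_proper [G_cvg wG]].
have G_u : fst @ G --> v := cvg_comp _ _ G_cvg (@cvg_fst _ _ _ _ (nbhs_filter h)).
have G_Phi : snd @ G --> h := cvg_comp _ _ G_cvg (@cvg_snd _ _ _ _ (nbhs_filter v)).
have h_lip : forall x y, `|h x - h y| <= `|x - y|.
  apply: (ptws_limit_lipschitz (F := snd @ G)) => //.
  by apply: wG; exists 0 => // n _ x y; exact: Phi_lipschitz.
have {}G_Phi x : p.2 x @[p --> G] --> h x.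
  exact: ((ptws_eval_cvg (fmap_filter snd _)).1 G_Phi x).
have /choice[D DP] : forall k : nat, exists D : seq V, forall x : V,
    `|x| <= k%:R -> exists2 d, d \in D & `|x - d| < k.+1%:R^-1.
  by move=> k; exact: (compact_finite_net (V_proper k%:R)).
pose P k n := `|v - u n| < k.+1%:R^-1 /\
  forall d, d \in D k -> `|h d - Phi x0 (b n) d| < k.+1%:R^-1.
have P_cofinal k N : exists2 n, (N <= n)%N & P k n.
  have e_gt0 : 0 < k.+1%:R^-1 :> R by [].
  have tail : G (w @` [set n | (N <= n)%N]).
    by apply: wG; exists N => // n /= Nn; exists n.
  have near_v : G [set p | `|v - p.1| < k.+1%:R^-1].
    by move/cvgrPdist_lt : G_u; exact.
  have near_h : G [set p | forall d, d \in D k -> `|h d - p.2 d| < k.+1%:R^-1].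
    by apply: near_all_seq => d; move/cvgrPdist_lt : (G_Phi d); exact.
  have [_ [[n Nn <-] [Pu Ph]]] := filter_ex (filterI tail (filterI near_v near_h)).
  by exists n.
have [f f_incr fP] := extract_increasing P_cofinal.
exists f => //; exists v, h; split.
  apply/cvgrPdist_lt => e e_gt0; near=> i.
  apply: lt_trans (fP i).1 _; near: i; exact: near_infty_natSinv_lt (PosNum e_gt0).
suff cvg_at x : Phi x0 (b (f i)) x @[i --> \oo] --> h x.
  by apply/ptws_eval_cvg => x; exact: cvg_at.
apply/cvgrPdist_lt => e e_gt0; near=> i.
have [d dD xd] : exists2 d, d \in D i & `|x - d| < i.+1%:R^-1.
  by apply: DP; near: i; exact: nbhs_infty_ger.
have hd := (fP i).2 d dD.
have i_small : i.+1%:R^-1 < e / 3.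
  by near: i; apply: near_infty_natSinv_lt (PosNum (divr_gt0 e_gt0 _)).
have := h_lip x d; have := Phi_lipschitz x0 (b (f i)) d x.
rewrite (distrC d x) => Phi_xd h_xd.
rewrite (_ : h x - _ = (h x - h d) + (h d - Phi x0 (b (f i)) d)
    + (Phi x0 (b (f i)) d - Phi x0 (b (f i)) x)); last by ring.
rewrite (_ : e = e / 3 + e / 3 + e / 3); last by field.
rewrite (le_lt_trans (ler_normD _ _))// ltrD//.
  rewrite (le_lt_trans (ler_normD _ _))// ltrD ?(lt_trans hd)//.
  exact: le_lt_trans h_xd (lt_trans xd i_small).
exact: le_lt_trans Phi_xd (lt_trans xd i_small).
Unshelve. all: end_near. Qed.

Lemma Phi_limit_eval {R : realType} {V : normedModType R} {x0 : V}
    {b : nat -> V} {h : {ptws V -> R}} :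
  Phi x0 (b i) @[i --> \oo] --> h ->
  forall x, Phi x0 (b i) x @[i --> \oo] --> h x.
Proof. by move=> /ptws_eval_cvg. Qed.

(** Moving the far point [b i] by [T] costs only [|b i - T (b i)|], so
    [T x] is asymptotically no farther from [b i] than [x]. *)
Lemma almost_fixed_limit_nonincreasing {R : realType} {V : normedModType R}
    {x0 : V} {T : V -> V} {b : nat -> V} {h : {ptws V -> R}} x :
  non_expansive T -> dist (b i) (T (b i)) @[i --> \oo] --> 0 ->
  Phi x0 (b i) @[i --> \oo] --> h -> h (T x) <= h x.
Proof.
move=> neT step0 /Phi_limit_eval b_h; rewrite -[leRHS]addr0.
apply: (ler_cvg_to (b_h (T x)) (cvgD (b_h x) step0)).
apply: nearW => i.
rewrite -[leRHS]/(Phi x0 (b i) x + dist (b i) (T (b i))) /Phi addrAC lerD2r.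
apply: (le_trans (ler_distD (T (b i)) _ _)).
by rewrite [dist (b i) _]distrC lerD2r neT.
Qed.

Lemma norm_direction_le1 {R : realType} {V : normedModType R} (x : V) :
  `| `|x|^-1 *: x| <= 1.
Proof.
rewrite normrZ normfV normr_id.
have [->|x_neq0] := eqVneq x 0; first by rewrite normr0 mulr0.
by rewrite mulVf ?normr_eq0.
Qed.

(** Going from [y] to [x] through the point at distance [|x|] on the ray of [y]
    exceeds [|y| - |x|] by the angular term only. *)
Lemma dist_norm_direction {R : realType} {V : normedModType R} (x y : V) :
  `|x| <= `|y| ->
  `|x - y| <= `|y| - `|x| + `|x| * `| `|x|^-1 *: x - `|y|^-1 *: y|.
Proof.
move=> xy; set u := `|x|^-1 *: x; set w := `|y|^-1 *: y.
have polar (z : V) : `|z| *: (`|z|^-1 *: z) = z.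
  have [->|z_neq0] := eqVneq z 0; first by rewrite !scaler0.
  by rewrite scalerA mulfV ?normr_eq0// scale1r.
have w_le1 : `|w| <= 1 by exact: norm_direction_le1.
have -> : x - y = `|x| *: (u - w) - (`|y| - `|x|) *: w.
  by rewrite scalerBr polar scalerBl polar opprB addrA subrK.
rewrite (le_trans (ler_normB _ _))// addrC (normrZ _ w).
rewrite (normrZ _ (u - w)) normr_id lerD2r.
have d_ge0 : 0 <= `|y| - `|x| by rewrite subr_ge0.
by rewrite (ger0_norm d_ge0) ler_piMr.
Qed.

(** A sequence that goes to infinity in an asymptotic direction is seen by its
    own limiting metric functional as going to -oo: two far terms of it are
    nearly aligned with the origin, so [|b j - b i| - |b i|] is close to
    [- |b j|] up to a fraction of [|b j|]. *)
Lemma metric_functional_cvgNy {R : realType} {V : normedModType R}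
    {x0 : V} {b : nat -> V} {v : V} {h : {ptws V -> R}} :
  `|b i| @[i --> \oo] --> +oo -> `|b i|^-1 *: b i @[i --> \oo] --> v ->
  Phi x0 (b i) @[i --> \oo] --> h -> h (b j) @[j --> \oo] --> -oo.
Proof.
move=> /cvgryPge b_oo /cvgrPdist_lt/(_ 4^-1) u_v /Phi_limit_eval b_h.
(* Beyond [N], directions differ by at most 1/2 from each other. *)
have [|N _ uN] := u_v; first by rewrite invr_gt0.
have bound j : (N <= j)%N -> h (b j) <= `|x0| - `|b j| / 2.
  move=> Nj; apply: (cvgr_to_le (b_h (b j))); near=> i.
  have bij : `|b j| <= `|b i| by near: i; exact: b_oo.
  have Ni : (N <= i)%N by near: i; exact: nbhs_infty_ge.
  have u_close : `| `|b j|^-1 *: b j - `|b i|^-1 *: b i| <= 2^-1.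
    rewrite (le_trans (ler_distD v _ _))//.
    have := uN _ Ni; have := uN _ Nj; rewrite [`|v - _ *: b j|]distrC; lra.
  have b_dist := dist_norm_direction _ _ bij.
  have x0_dist : `|b i| - `|x0| <= dist x0 (b i).
    by rewrite /dist distrC lerB_dist.
  have prod_le := ler_wpM2l (normr_ge0 (b j)) u_close.
  rewrite /Phi {1}/dist; lra.
apply/cvgrNyPle => A; near=> j.
have Nj : (N <= j)%N by near: j; exact: nbhs_infty_ge.
have : 2 * (`|x0| - A) <= `|b j| by near: j; exact: b_oo.
have := bound j Nj; lra.
Unshelve. all: end_near. Qed.

(** * Unbounded orbits *)

(** All orbits stay at bounded distance from the orbit of 0, so only the latter
    matters; the finitely many terms before [N] are bounded in any case. *)
Lemma bounded_orbits_or_cofinal {R : realType} {V : normedModType R}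
    {T : V -> V} : non_expansive T ->
  bounded_orbits T \/
  forall k N, exists2 n, (N <= n)%N & k%:R <= `|iter n T 0|.
Proof.
move=> neT; have [|unbounded] := pselect (bounded_orbits T); first by left.
right => k N; apply: contrapT => no_n; apply: unbounded => x.
have tail n : (N <= n)%N -> `|iter n T 0| <= k%:R.
  by move=> Nn; rewrite leNgt; apply/negP => /ltW k_le; apply: no_n; exists n.
pose M := k%:R + \sum_(i < N) `|iter i T 0|.
have orbit0_le n : `|iter n T 0| <= M.
  have [nN|/tail n_le] := ltnP n N.
    rewrite /M (bigD1 (Ordinal nN))//= addrCA lerDl addr_ge0 ?ler0n//.
    by apply: sumr_ge0 => i _; exact: normr_ge0.
  by rewrite (le_trans n_le)// lerDl sumr_ge0.
exists (M + `|x|); split; first exact: num_real.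
move=> r /ltW M_le _ [n _ <-] /=; apply: le_trans M_le.
have := non_expansive_iter n neT x 0.
rewrite /dist subr0 => nx_le.
rewrite -(subrK (iter n T 0) (iter n T x)) (le_trans (ler_normD _ _))//.
by rewrite addrC lerD.
Qed.

Theorem corollary1p3 (R : realType) (V : normedModType R)
    (Vfin : finite_dimensional V) (x0 : V) (T : V -> V)
    (T_firm : firm T) (T_nonexp : non_expansive T)
    (T_rate : escape_rate T = 0) :
  bounded_orbits T \/
  exists h : {ptws V -> R},
    [/\ metric_functional x0 h,
        forall x : V,
          nonincreasing_seq (fun n : nat => h (iter n T x)) /\
          h (iter n T x) @[n --> \oo] --> -oo &
        seq_limit_point (fun n : nat => Phi x0 (iter n T 0)) h].
Proof.
have [|cofinal] := bounded_orbits_or_cofinal T_nonexp; [by left|right].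
have [g g_incr g_ge] := extract_increasing cofinal.
pose b i := iter (g i) T 0; pose u i := `|b i|^-1 *: b i.
have u_le1 i : `|u i| <= 1 by exact: norm_direction_le1.
have [f f_incr [v [h [u_v b_h]]]] := Phi_cvg_subsequence x0 b u
  (fun r => finite_dimensional_closed_ball_compact r Vfin) u_le1.
pose gf := g \o f.
have gf_incr : increasing_seq gf.
  by move=> m n; exact: etrans (g_incr _ _) (f_incr _ _).
have b_oo : `|b (f i)| @[i --> \oo] --> +oo.
  apply/cvgryPge => A; near=> i; apply: (le_trans _ (g_ge (f i))).
  near: i; exact: (increasing_seq_cvg_oo f_incr _ (nbhs_infty_ger A)).
have step0 : dist (b (f i)) (T (b (f i))) @[i --> \oo] --> 0.
  rewrite -T_rate.
  exact: (cvg_comp gf _ (increasing_seq_cvg_oo gf_incr)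
    (firm_step_cvg_escape_rate T_firm T_nonexp)).
have h_lip : forall x y, `|h x - h y| <= `|x - y|.
  apply: (ptws_limit_lipschitz _ _ b_h).
  by exists 0 => // i _ x y; exact: Phi_lipschitz.
have h_T x : h (T x) <= h x by exact: almost_fixed_limit_nonincreasing step0 b_h.
exists h; split; last by exists gf.
- apply: (closed_cvg (closure (range (Phi x0))) _ _ h b_h).
    exact: closed_closure.
  by apply: nearW => i; apply: subset_closure; exists (b (f i)).
- move=> x.
  have noninc : nonincreasing_seq (fun n => h (iter n T x)).
    by apply/nonincreasing_seqP => n; exact: h_T.
  split=> //; apply/cvgrNyPle => A.
  have /cvgrNyPle /(_ (A - `|x|)) [j _ h_bj] := metric_functional_cvgNy b_oo u_v b_h.
  (* The orbits of [x] and 0 stay within [|x|] of each other. *)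
  exists (gf j) => // n /= jn; apply: (le_trans (noninc _ _ jn)).
  have h_le := h_bj j (leqnn j).
  have x_near := non_expansive_iter (gf j) T_nonexp x 0.
  rewrite /dist subr0 in x_near.
  have := le_trans (ler_norm _) (le_trans (h_lip _ _) x_near).
  move: h_le; rewrite /= /b /gf/=; lra.
Unshelve. all: end_near. Qed.
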